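(* Let $D$ be any declaration for $\widetilde{\mathcal L}^{\nu}_{\mathsf{iocos}}$ and interpret formulae in the environment $[\![D]\!]_{\max}$. Then for all states $i,s$ of the LTS, $i\mathrel{\mathsf{iocos}}s$ holds if and only if for every $\phi\in\widetilde{\mathcal L}^{\nu}_{\mathsf{iocos}}$, $s\models\phi$ implies $i\models\phi$.
   Context: Actions: disjoint finite sets $I$ (inputs $a?$) and $O$ (outputs $a!$, including quiescence $\delta!$). An LTS with inputs and outputs is $(S,I,O,\to)$ with $\to\subseteq S\times(I\cup O)\times S$ such that $p\xrightarrow{\delta!}p'$ iff $p=p'$ and $p$ has no $a!$-transition for $a!\in O\setminus\{\delta!\}$; LTSs are image-finite. $\mathsf{ins}(p)$ is the set of inputs $a?$ such that $p$ has an $a?$-transition. An iocos-relation $R$ satisfies for every $(p,q)\in R$: (1) $\mathsf{ins}(q)\subseteq\mathsf{ins}(p)$; (2) for every $a?\in\mathsf{ins}(q)$ and $p\xrightarrow{a?}p'$ there is $q\xrightarrow{a?}q'$ with $(p',q')\in R$; (3) for every $a!\in O$ and $p\xrightarrow{a!}p'$ there is $q\xrightarrow{a!}q'$ with $(p',q')\in R$; $\mathsf{iocos}$ is the union of all iocos-relations. Fix a countably infinite set $\mathsf{Var}$ of formula variables. $\widetilde{\mathcal L}^{\nu}_{\mathsf{iocos}}$: $\phi::=X\mid\mathrm{tt}\mid\mathrm{ff}\mid\phi\wedge\phi\mid\phi\vee\phi\mid[\![a?]\!]\phi\mid[a!]\phi$ with $X\in\mathsf{Var}$. For an environment $\sigma:\mathsf{Var}\to\mathcal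 P(S)$: $(\sigma,p)\models X$ iff $p\in\sigma(X)$; Boolean constructs as usual; $(\sigma,p)\models[a!]\phi$ iff $(\sigma,p')\models\phi$ for all $p\xrightarrow{a!}p'$; $(\sigma,p)\models[\![a?]\!]\phi$ iff $p$ has an $a?$-transition and $(\sigma,p')\models\phi$ for all $p\xrightarrow{a?}p'$. Let $[\![\phi]\!]\sigma=\{p\mid(\sigma,p)\models\phi\}$. A declaration is a function $D:\mathsf{Var}\to\widetilde{\mathcal L}^{\nu}_{\mathsf{iocos}}$; it induces the monotone map $[\![D]\!]$ on environments (ordered pointwise by inclusion) given by $([\![D]\!]\sigma)(X)=[\![D(X)]\!]\sigma$, whose greatest fixed point is $[\![D]\!]_{\max}$. We write $p\models\phi$ for $(\,[\![D]\!]_{\max},p)\models\phi$. *)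

(* Defs.v *)
From mathcomp Require Import all_boot boolp classical_sets functions cardinality.

Set Implicit Arguments.
Unset Strict Implicit.
Unset Printing Implicit Defensive.

Local Open Scope classical_set_scope.

(* The sum type I + O makes the sets of inputs and outputs disjoint: inl a is
   the action a? and inr a is the action a!; delta : O is quiescence. *)
Record lts (I O : finType) (delta : O) := Lts {
  state :> Type ;
  trans : state -> I + O -> state -> Prop ;
  trans_delta : forall p p' : state,
    trans p (inr delta) p' <->
    p = p' /\ forall a : O, a != delta -> ~ exists q, trans p (inr a) q ;
  image_finite : forall (p : state) (a : I + O), finite_set [set p' | trans p a p']
}.

Section Iocos.
Variables (I O : finType) (delta : O) (S : lts I delta).

Definition ins (p : S) : set I := [set a | exists p', trans p (inl a) p'].

Definition iocos_relation (R : S -> S -> Prop) : Prop :=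
  forall p q, R p q ->
  [/\ ins q `<=` ins p,
      forall a p', ins q a -> trans p (inl a) p' ->
        exists2 q', trans q (inl a) q' & R p' q'
    & forall a p', trans p (inr a) p' ->
        exists2 q', trans q (inr a) q' & R p' q'].

Definition iocos (p q : S) : Prop := exists2 R, iocos_relation R & R p q.

End Iocos.

Inductive form (I O Var : Type) : Type :=
| FVar of Var
| FTrue
| FFalse
| FAnd of form I O Var & form I O Var
| FOr of form I O Var & form I O Var
| FIn of I & form I O Var     (* [[a?]] phi *)
| FOut of O & form I O Var.   (* [a!] phi *)

Arguments FVar {I O Var}.
Arguments FTrue {I O Var}.
Arguments FFalse {I O Var}.

Definition declaration (I O Var : Type) := Var -> form I O Var.

Section Semantics.
Variables (I O : finType) (delta : O) (S : lts I delta) (Var : Type).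

Definition env := Var -> set S.

Fixpoint sat (sigma : env) (p : S) (phi : form I O Var) : Prop :=
  match phi with
  | FVar X => sigma X p
  | FTrue => True
  | FFalse => False
  | FAnd phi1 phi2 => sat sigma p phi1 /\ sat sigma p phi2
  | FOr phi1 phi2 => sat sigma p phi1 \/ sat sigma p phi2
  | FIn a phi1 => (exists p', trans p (inl a) p') /\
                  forall p', trans p (inl a) p' -> sat sigma p' phi1
  | FOut a phi1 => forall p', trans p (inr a) p' -> sat sigma p' phi1
  end.

Definition sem (phi : form I O Var) (sigma : env) : set S :=
  [set p | sat sigma p phi].

Definition sem_decl (D : declaration I O Var) (sigma : env) : env :=
  fun X => sem (D X) sigma.

Definition env_le (sigma tau : env) : Prop := forall X, sigma X `<=` tau X.

Definition greatest_fixpoint (F : env -> env) (sigma : env) : Prop :=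
  F sigma = sigma /\ forall tau, F tau = tau -> env_le tau sigma.

(* The default value is irrelevant: see decl_maxP. *)
Definition decl_max (D : declaration I O Var) : env :=
  xget (fun=> set0) [set sigma | greatest_fixpoint (sem_decl D) sigma].

Definition models (D : declaration I O Var) (p : S) (phi : form I O Var) : Prop :=
  sat (decl_max D) p phi.

Lemma sem_decl_monotone (D : declaration I O Var) (sigma tau : env) :
  env_le sigma tau -> env_le (sem_decl D sigma) (sem_decl D tau).
Proof.
move=> le_st X p; rewrite /sem_decl /sem /=.
elim: (D X) p => [Y|||f IHf g IHg|f IHf g IHg|a f IHf|a f IHf] p //=.
- exact: le_st.
- by case=> /IHf ? /IHg.
- by case=> [/IHf|/IHg]; [left|right].
- by case=> ? h; split=> // p' /h /IHf.
- by move=> h p' /h /IHf.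
Qed.

Lemma env_le_anti (sigma tau : env) :
  env_le sigma tau -> env_le tau sigma -> sigma = tau.
Proof. by move=> h1 h2; apply/funext => X; apply/seteqP; split. Qed.

Lemma greatest_fixpoint_unique (F : env -> env) (sigma tau : env) :
  greatest_fixpoint F sigma -> greatest_fixpoint F tau -> sigma = tau.
Proof.
by move=> [fs gs] [ft gt]; apply: env_le_anti; [exact: gt|exact: gs].
Qed.

Lemma decl_maxP (D : declaration I O Var) :
  greatest_fixpoint (sem_decl D) (decl_max D).
Proof.
pose m : env := fun X => [set p | exists2 s, env_le s (sem_decl D s) & s X p].
have le_m s : env_le s (sem_decl D s) -> env_le s m by move=> hs X p sp; exists s.
have m_post : env_le m (sem_decl D m).
  move=> X p [s hs /hs]; exact/sem_decl_monotone/le_m.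
have m_fix : sem_decl D m = m.
  by apply: env_le_anti => //; apply: le_m; exact: sem_decl_monotone.
have m_gfp : greatest_fixpoint (sem_decl D) m.
  by split=> // t ht; apply: le_m; rewrite ht => X.
exact: (xgetI (fun=> set0) m_gfp).
Qed.

End Semantics.

(* Main.v *)
(* The denotation of a formula is closed under going down along iocos: pulling
   the greatest fixed point back along iocos gives a post-fixed point of the
   declaration, so it lies below the greatest fixed point. Conversely, the
   preorder induced by the logic is itself an iocos-relation: if p' were below
   no a-successor of q, image-finiteness would allow the disjunction Phi of
   formulae separating p' from each of these successors, and [[a?]]Phi or
   [a!]Phi would separate p from q. *)
Require Import Defs.
From mathcomp Require Import all_boot boolp classical_sets functions cardinality.

Set Implicit Arguments.
Unset Strict Implicit.
Unset Printing Implicit Defensive.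

Local Open Scope classical_set_scope.
Local Open Scope card_scope.

(** Knaster-Tarski: [greatest_fixpoint] compares only with fixed points, but the union [m] of all
    post-fixed points is itself one. *)
Lemma le_decl_max (I O : finType) (delta : O) (S : lts I delta) (Var : Type)
    (D : declaration I O Var) (tau : env S Var) :
  env_le tau (sem_decl D tau) -> env_le tau (decl_max D).
Proof.
move=> tau_post.
pose m : env S Var := fun X =>
  [set p | exists2 r : env S Var, env_le r (sem_decl D r) & r X p].
have le_m r : env_le r (sem_decl D r) -> env_le r m by move=> hr X p rp; exists r.
have m_post : env_le m (sem_decl D m).
  by move=> X p [r hr /hr]; exact/sem_decl_monotone/le_m.
have m_fix : sem_decl D m = m.
  by apply: env_le_anti => //; apply: le_m; exact: sem_decl_monotone.
move=> X p /(le_m _ tau_post); exact: (decl_maxP S D).2.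
Qed.

Lemma iocos_refl (I O : finType) (delta : O) (S : lts I delta) (p : S) :
  iocos p p.
Proof. by exists eq => // q _ <-; split=> // a q' *; exists q'. Qed.

Lemma iocos_is_relation (I O : finType) (delta : O) (S : lts I delta) :
  iocos_relation (@iocos I O delta S).
Proof.
move=> p q [R Rrel Rpq]; case: (Rrel p q Rpq) => ins_qp inR outR.
split=> // a p'.
- by move=> qa /(inR _ _ qa)[q' ? ?]; exists q' => //; exists R.
- by move=> /outR[q' ? ?]; exists q' => //; exists R.
Qed.

(** An arbitrary [sigma] need not be closed under [iocos]; pulling it back makes the variable case
    immediate. *)
Lemma sat_iocos (I O : finType) (delta : O) (S : lts I delta) (Var : Type)
    (sigma : env S Var) (phi : form I O Var) (p q : S) :
  iocos p q -> sat sigma q phi ->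
  sat (fun X => [set p | exists2 q, iocos p q & sigma X q]) p phi.
Proof.
elim: phi p q => [X|||f IHf g IHg|f IHf g IHg|a f IHf|a f IHf] p q pq //=.
- by exists q.
- by case=> /(IHf _ _ pq) ? /(IHg _ _ pq).
- by case=> [/(IHf _ _ pq)|/(IHg _ _ pq)]; [left|right].
- have [ins_qp inR _] := iocos_is_relation pq.
  case=> qa h; split; first exact: ins_qp.
  by move=> p' /(inR _ _ qa)[q' /h qf p'q']; exact: IHf qf.
- have [_ _ outR] := iocos_is_relation pq.
  by move=> h p' /outR[q' /h qf p'q']; exact: IHf qf.
Qed.

Lemma models_iocos (I O : finType) (delta : O) (S : lts I delta) (Var : Type)
    (D : declaration I O Var) (phi : form I O Var) (p q : S) :
  iocos p q -> models D q phi -> models D p phi.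
Proof.
set tau : env S Var :=
  fun X => [set p | exists2 q, iocos p q & decl_max D X q].
(* Reflexivity of [iocos] puts [decl_max D] below [tau]; unfolding [decl_max D] once makes [tau]
   post-fixed by [sat_iocos]. *)
have -> : models D p phi = sat tau p phi.
  rewrite /models; congr (sat _ p phi); apply: env_le_anti => [X r Xr|].
    by exists r => //; exact: iocos_refl.
  apply: le_decl_max => X r [r' rr']; rewrite -(decl_maxP S D).1.
  exact: sat_iocos.
exact: sat_iocos.
Qed.

Lemma finite_set_elim (T : Type) (P : set T -> Prop) :
  P set0 -> (forall x A, P A -> P (x |` A)) ->
  forall A, finite_set A -> P A.
Proof.
(* States form a bare type; a classical choice structure on it makes enumeration by a sequence
   available. *)
elim/Pchoice: T => T in P *.
move=> P0 PU A /finite_seqP[r ->]; elim: r => [|x r IHr].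
  by rewrite classical_sets.set_nil.
suff -> : [set` x :: r] = x |` [set` r] by exact: PU.
apply/seteqP; split=> y; rewrite /= inE; first by move=> /predU1P.
by move=> ?; exact/predU1P.
Qed.

Lemma finite_separation (I O : finType) (delta : O) (S : lts I delta)
    (Var : Type) (sigma : env S Var) (p : S) (A : set S) :
  finite_set A ->
  (forall q, A q ->
     exists2 phi : form I O Var, sat sigma q phi & ~ sat sigma p phi) ->
  exists2 phi : form I O Var,
    forall q, A q -> sat sigma q phi & ~ sat sigma p phi.
Proof.
move: A; apply: finite_set_elim => [|q A IHA] sepA.
  by exists FFalse => //= ? [].
have [phi qphi Nphi] := sepA q (or_introl erefl).
have [|psi Apsi Npsi] := IHA; first by move=> r Ar; apply: sepA; right.
exists (FOr phi psi) => [r [->|/Apsi]|[]] //=; by [left|right].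
Qed.

(** The hypothesis is what preservation of a box formula yields along one transition to [p'];
    keeping [x] arbitrary serves inputs and outputs alike. *)
Lemma models_successor (I O : finType) (delta : O) (S : lts I delta)
    (Var : Type) (D : declaration I O Var) (p' q : S) (x : I + O) :
  (forall phi : form I O Var,
     (forall q', trans q x q' -> models D q' phi) -> models D p' phi) ->
  exists2 q', trans q x q' &
    forall phi : form I O Var, models D q' phi -> models D p' phi.
Proof.
move=> box_sub; apply: contrapT => no_succ.
have [|phi succ_phi] := @finite_separation _ _ _ S _ (decl_max D) p' _ (image_finite q x).
  move=> q' qq'; apply: contrapT => no_sep; apply: no_succ; exists q' => // phi.
  by move=> q'phi; apply: contrapT => Np'phi; apply: no_sep; exists phi.
by apply; exact: box_sub.
Qed.

Theorem theorem3 (I O : finType) (delta : O) (S : lts I delta)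
    (Var : Type) (hVar : [set: Var] #= [set: nat])
    (D : declaration I O Var) (i s : S) :
  iocos i s <->
  (forall phi : form I O Var, models D s phi -> models D i phi).
Proof.
split=> [is_ phi|logic_is]; first exact: models_iocos.
exists (fun p q => forall phi : form I O Var, models D q phi -> models D p phi) => //.
move=> p q pq; split=> [a qa|a p' qa pp'|a p' pp'].
(* [FIn a FTrue] says exactly that [a] is enabled. *)
- by have [] := pq (FIn a FTrue) (conj qa (fun _ _ => Logic.I)).
(* [qa] provides the existential half of [FIn a phi] at [q]. *)
- apply: models_successor => phi hphi.
  by have [_] := pq (FIn a phi) (conj qa hphi); apply.
- by apply: models_successor => phi hphi; exact: (pq (FOut a phi) hphi).
Qed.
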